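(* Let $p\neq 2,5$ be a prime and let $a$ be a positive integer. Then $$\sum_{k=0}^{p^a-1}(-1)^k\binom{2k}{k}\equiv\left(\frac{p^a}{5}\right)\left(1-2F_{p^a-\left(\frac{p^a}{5}\right)}\right)\pmod{p^3},$$ where $\left(\frac{\cdot}{5}\right)$ is the Legendre (Jacobi) symbol and $F_n$ is the $n$-th Fibonacci number.
   Context: The Fibonacci sequence is given by $F_0=0$, $F_1=1$ and $F_{n+1}=F_n+F_{n-1}$ for $n=1,2,3,\ldots$. *)

(* Defs.v *)
From mathcomp Require Import all_boot all_order all_algebra.

Set Implicit Arguments.
Unset Strict Implicit.
Unset Printing Implicit Defensive.

Import GRing.Theory Num.Theory.

Fixpoint fib (n : nat) : nat :=
  match n with
  | 0 => 0
  | m.+1 => if m is k.+1 then fib m + fib k else 1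
  end.

(* The Legendre symbol (m / q); meaningful when q is an odd prime. *)
Definition legendre (m : int) (q : nat) : int :=
  if (q%:Z %| m)%Z then 0%R
  else if [exists x : 'I_q, ((x%:Z ^+ 2)%R == m %[mod q%:Z])%Z] then 1%R
  else (-1)%R.

(* Main.v *)
Require Import Defs.
From mathcomp Require Import all_boot all_order all_algebra.
From mathcomp Require Import all_field ring zify.

(** Write q = p^a. Induction on n gives
      sum_(k < n) (-1)^k C(2k, k) = sum_(k < n) (-1)^k C(2n, k) F_(2(n - k)).
    For n = q put (1 - X)^q = 1 - X^q + p h in Z[X]. Squaring and reading off
    the coefficients below X^q turns the right-hand side into
    2 F_q - F_(2q) + p^2 W, with W the sum of the F_(2(q - k)) weighted by the
    coefficients of h^2. If F_q = (q/5) + p f and L_q = 1 + p l, the congruence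
    amounts to W = f l mod p, while L_q^2 + 4 = 5 F_q^2 gives l = 5 (q/5) f.

    Modulo p, h(X) = - L1(X^(q/p)) where L_n = sum_(0 < k < p) X^k / k^n, and
    comparing derivatives shows that the part of L1^2 of degree < p is
    2 L2(1) - 2 L2(1 - X). Over a field of characteristic p containing the
    golden ratio, W is thus a combination of the values of L2 at the golden
    ratio and its opposite; the functional equations of the finite dilogarithm
    express these through L1^2, that is through l^2. *)

Import GRing.Theory Num.Theory.
Local Open Scope ring_scope.

(** * Fibonacci identities and the reduction of the central binomial sum *)

Local Notation F n := ((fib n)%:Z).

Lemma fibSS n : F n.+2 = F n.+1 + F n.
Proof. by rewrite -PoszD. Qed.

(** The cutoff [m] is independent of the row [N], so that Pascal's rule also applies to half a
    row. *)
Lemma sum_pascal (f : nat -> int) N m :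
  \sum_(k < m.+1) 'C(N.+1, k)%:Z * f k =
  \sum_(k < m.+1) 'C(N, k)%:Z * f k + \sum_(k < m) 'C(N, k)%:Z * f k.+1.
Proof.
rewrite !big_ord_recl /= !bin0 -addrA -big_split /=; congr (_ + _).
by apply: eq_bigr => k _; rewrite /bump /= binS PoszD mulrDl.
Qed.

Lemma sum_pascal_full (f : nat -> int) n :
  \sum_(k < n.+2) 'C(n.+1, k)%:Z * f k =
  \sum_(k < n.+1) 'C(n, k)%:Z * (f k + f k.+1).
Proof.
rewrite sum_pascal big_ord_recr /= bin_small // mul0r addr0 -big_split /=.
by apply: eq_bigr => k _; rewrite mulrDr.
Qed.

(** For the golden ratio phi this is (1 + phi)^n = phi^(2n), read through Binet's formula. *)
Lemma sum_bin_fib n m : \sum_(k < n.+1) 'C(n, k)%:Z * F (k + m) = F (n + n + m).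
Proof.
elim: n m => [|n IHn] m; first by rewrite big_ord1 bin0 mul1r.
rewrite (sum_pascal_full (fun k => F (k + m))).
have -> : (n.+1 + n.+1 + m = n + n + m.+2)%N by lia.
rewrite -IHn; apply: eq_bigr => k _.
by rewrite !addnS addSn fibSS addrC.
Qed.

(** The counterpart (phi^2 - 1)^n = phi^n. *)
Lemma sum_signed_bin_fib n m :
  \sum_(k < n.+1) 'C(n, k)%:Z * ((-1) ^+ k * F (2 * (n - k) + m)) = F (n + m).
Proof.
elim: n m => [|n IHn] m; first by rewrite big_ord1 bin0 !mul1r.
rewrite (sum_pascal_full (fun k => (-1) ^+ k * F (2 * (n.+1 - k) + m))).
rewrite addSnnS -IHn; apply: eq_bigr => k _; congr (_ * _).
have -> : (2 * (n.+1 - k) + m = (2 * (n - k) + m).+2)%N by have := ltn_ord k; lia.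
rewrite subSS fibSS addnS exprS; ring.
Qed.

(** Two uses of Pascal's rule lower row 2n + 2 to row 2n, and F_(j+4) - 2 F_(j+2) + F_j = F_(j+2)
    restores the weights. The term k = n supplies the new central coefficient. *)
Lemma sum_signed_central_bin n :
  \sum_(k < n) (-1) ^+ k * 'C(2 * k, k)%:Z =
  \sum_(k < n) 'C(2 * n, k)%:Z * ((-1) ^+ k * F (2 * (n - k))).
Proof.
elim: n => [|n IHn]; first by rewrite !big_ord0.
rewrite big_ord_recr /= {}IHn.
(* Since [f] vanishes at [n.+1], both sums of Pascal's rule can share the range k <= n. *)
have step N (f : nat -> int) : f n.+1 = 0 ->
    \sum_(k < n.+1) 'C(N.+1, k)%:Z * f k =
    \sum_(k < n.+1) 'C(N, k)%:Z * (f k + f k.+1).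
  move=> f0; rewrite sum_pascal.
  have -> : \sum_(k < n) 'C(N, k)%:Z * f k.+1 =
            \sum_(k < n.+1) 'C(N, k)%:Z * f k.+1.
    by rewrite [RHS]big_ord_recr /= f0 mulr0 addr0.
  by rewrite -big_split; apply: eq_bigr => k _; rewrite mulrDr.
pose f k := (-1) ^+ k * F (2 * (n.+1 - k)).
have -> : (2 * n.+1 = (2 * n).+2)%N by lia.
rewrite (step _ f); last by rewrite /f subnn mulr0.
rewrite (step _ (fun k => f k + f k.+1)); last first.
  (* Truncated subtraction makes [f] vanish at [n.+2] as well. *)
  by rewrite /f subnn (_ : n.+1 - n.+2 = 0)%N ?mulr0 //; lia.
rewrite big_ord_recr /=; congr (_ + _).
  apply: eq_bigr => k _; congr (_ * _); rewrite /f.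
  have [j def_n] : exists j, n = (k + j.+1)%N.
    by exists (n - k.+1)%N; have := ltn_ord k; lia.
  move: (nat_of_ord k) def_n => {}k ->.
  have -> : (2 * (k + j.+1 - k) = j.*2.+2)%N by lia.
  have -> : (2 * ((k + j.+1).+1 - k) = j.*2.+4)%N by lia.
  have -> : (2 * ((k + j.+1).+1 - k.+2) = j.*2)%N by lia.
  rewrite !exprS !fibSS; ring.
rewrite /f subSnn subnn (_ : n.+1 - n.+2 = 0)%N; last by lia.
by rewrite mulr0 !mulr0 !addr0 mulr1 mulrC.
Qed.

(** The factor [2 * F n.+1 - F n] is the Lucas number L_n, written in this form throughout. *)
Lemma fib_double n :
  F (n + n) = F n * (2 * F n.+1 - F n) /\ F (n + n).+1 = F n.+1 ^+ 2 + F n ^+ 2.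
Proof.
elim: n => [|n [IH0 IH1]]; first by [].
have -> : (n.+1 + n.+1 = (n + n).+2)%N by lia.
by rewrite !fibSS IH0 IH1; split; ring.
Qed.

Lemma cassini n :
  F n.+1 ^+ 2 - F n.+1 * F n - F n ^+ 2 = (-1) ^+ n.
Proof.
elim: n => [|n IHn]; first by [].
by rewrite [RHS]exprS -IHn fibSS; ring.
Qed.

Lemma binet (R : comNzRingType) (x y : R) n :
  x + y = 1 -> x * y = -1 -> (x - y) * (F n)%:~R = x ^+ n - y ^+ n.
Proof.
move=> xDy xMy.
suff: (x - y) * (F n)%:~R = x ^+ n - y ^+ n /\
      (x - y) * (F n.+1)%:~R = x ^+ n.+1 - y ^+ n.+1 by case.
elim: n => [|n [IH0 IH1]]; first by rewrite !expr0 !expr1 subrr mulr0 mulr1.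
split=> //; rewrite fibSS intrD mulrDr IH0 IH1 !exprS.
have -> : y = 1 - x by rewrite -xDy; ring.
(* The inserted factor is - x y = 1; with it the recurrence becomes a polynomial identity in [x]. *)
have -> : x ^+ n - (1 - x) ^+ n = - (x * (1 - x)) * (x ^+ n - (1 - x) ^+ n).
  by rewrite (_ : 1 - x = y) ?xMy ?opprK ?mul1r // -xDy; ring.
ring.
Qed.

(** * Finite polylogarithms in odd characteristic p and their functional equations *)

Section FinitePolylog.

Variables (K : fieldType) (p : nat).
Hypotheses (pcharK : p \in [pchar K]) (p_odd : odd p).

(* The term k = 0 is X^0 / 0^n, which is 0 for n > 0 since 0^-1 = 0. *)
Definition finlog (n : nat) : {poly K} := \poly_(k < p) (k%:R ^- n).

Let p_prime : prime p := pcharf_prime pcharK.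
Let p_gt0 : (0 < p)%N := prime_gt0 p_prime.

Lemma natr_p_sub k : (k <= p)%N -> (p - k)%:R = - k%:R :> K.
Proof. by move=> le_kp; rewrite natrB // (pcharf0 pcharK) sub0r. Qed.

Lemma natr2_neq0 : (2 : K) != 0.
Proof.
rewrite -[2]/(2%:R) -(dvdn_pcharf pcharK) -prime_coprime //.
by rewrite coprime_sym coprime2n.
Qed.

Lemma horner_finlog n (x : K) :
  (finlog n).[x] = \sum_(k < p) x ^+ k / k%:R ^+ n.
Proof. by rewrite horner_poly; apply: eq_bigr => k _; rewrite mulrC. Qed.

Lemma horner_finlog1 n (x : K) : (0 < n)%N ->
  (finlog n).[x] = \sum_(1 <= k < p) x ^+ k / k%:R ^+ n.
Proof.
move=> n_gt0; rewrite horner_finlog -(big_mkord xpredT (fun k => x ^+ k / k%:R ^+ n)).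
by rewrite big_ltn // [0%:R ^+ n]expr0n eqn0Ngt n_gt0 invr0 mulr0 add0r.
Qed.

(** Inversion formula: reverse the sum by k -> p - k, which equals - k in K. *)
Lemma horner_finlogV n (x : K) : (0 < n)%N -> x != 0 ->
  x ^+ p * (finlog n).[x^-1] = (-1) ^+ n * (finlog n).[x].
Proof.
move=> n_gt0 x_neq0; rewrite !horner_finlog1 // [in RHS]big_nat_rev /= !mulr_sumr.
apply: eq_big_nat => k /andP[k_gt0 lt_kp].
rewrite add1n subSS natr_p_sub ?(ltnW lt_kp) // (exprNn k%:R) invfM.
rewrite -[((-1) ^+ n)^-1]exprVn invrN1 mulrCA (mulrCA ((-1) ^+ n)).
rewrite signrMK // mulrA exprVn; congr (_ / _).
by rewrite -[in LHS](subnK (ltnW lt_kp)) exprD mulrC mulfK ?expf_neq0.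
Qed.

Lemma horner_finlog2_sqr (x : K) :
  (1 + x ^+ p) * (finlog 2).[x] + (1 - x ^+ p) * (finlog 2).[- x] =
  (finlog 2).[x ^+ 2] / 2.
Proof.
(* Doubling permutes the residues modulo p: 2j is an even k or p + k, k odd. *)
have sum_even N (f : nat -> K) :
    \sum_(j < N) f (2 * j)%N = \sum_(m < 2 * N) if odd m then 0 else f m.
  elim: N => [|N IHN]; first by rewrite !big_ord0.
  have -> : (2 * N.+1 = (2 * N).+2)%N by lia.
  by rewrite !big_ord_recr /= -IHN !oddM /= addr0.
have two_neq0 := natr2_neq0.
pose f k := 2 * x ^+ k / k%:R ^+ 2.
have -> : (finlog 2).[x ^+ 2] / 2 = \sum_(j < p) f (2 * j)%N.
  rewrite horner_finlog mulr_suml; apply: eq_bigr => k _.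
  rewrite /f -exprM natrM exprMn.
  by rewrite !expr2 !invfM; move: (k%:R^-1 : K) => c; field.
rewrite sum_even mul2n -addnn big_split_ord /= -big_split /=.
rewrite !horner_finlog !mulr_sumr -big_split; apply: eq_bigr => k _ /=.
rewrite /f natrD (pcharf0 pcharK) add0r exprD oddD p_odd /=.
rewrite exprNn -[(-1) ^+ k]signr_odd.
by case: (odd k) => /=; rewrite ?expr0 ?expr1; ring.
Qed.

Lemma coef_finlog n i : (finlog n)`_i = if (i < p)%N then i%:R ^- n else 0.
Proof. exact: coef_poly. Qed.

Lemma size_finlog n : (size (finlog n) <= p)%N.
Proof. exact: size_poly. Qed.

Lemma horner_take_sqr (x : K) :
  (take_poly p (finlog 1 ^+ 2)).[x] =
  \sum_(1 <= i < p) \sum_(1 <= j < p | (i + j < p)%N) x ^+ (i + j) / (i%:R * j%:R).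
Proof.
have fE : finlog 1 = \sum_(1 <= i < p) (i%:R^-1 : K) *: 'X^i.
  rewrite /finlog poly_def -(big_mkord xpredT (fun i => (i%:R ^- 1 : K) *: 'X^i)).
  by rewrite big_ltn // invr0 scale0r add0r.
rewrite expr2 fE mulr_suml take_poly_sum horner_sum; apply: eq_bigr => i _.
rewrite mulr_sumr take_poly_sum horner_sum [in RHS]big_mkcond /=.
apply: eq_bigr => j _.
rewrite -scalerAl -scalerAr scalerA take_polyZ -exprD hornerZ.
case: ltnP => [lt_ij|le_ij].
  by rewrite take_poly_id ?size_polyXn // hornerXn invfM mulrC.
by rewrite -['X^_]mul1r take_polyMXn (eqP le_ij) take_poly0l mul0r horner0 mulr0.
Qed.

(** Split the pairs (i, j) by comparing i + j with p. On the diagonal i + j = p the denominator is -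
    i^2; the upper part is the lower one at x^-1 after (i, j) -> (p - i, p - j). *)
Lemma horner_finlog1_sqr (x : K) : x != 0 ->
  (finlog 1).[x] ^+ 2 =
  (take_poly p (finlog 1 ^+ 2)).[x] - (finlog 2).[1] * x ^+ p
  + x ^+ (p + p) * (take_poly p (finlog 1 ^+ 2)).[x^-1].
Proof.
move=> x_neq0; rewrite !horner_take_sqr.
pose f i j : K := x ^+ (i + j) / (i%:R * j%:R).
have -> : (finlog 1).[x] ^+ 2 = \sum_(1 <= i < p) \sum_(1 <= j < p) f i j.
  rewrite expr2 horner_finlog1 // mulr_suml; apply: eq_bigr => i _.
  rewrite mulr_sumr; apply: eq_bigr => j _.
  by rewrite /f exprD invfM mulrACA.
have split3 i : \sum_(1 <= j < p) f i j =
    \sum_(1 <= j < p | (i + j < p)%N) f i j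
    + \sum_(1 <= j < p | (i + j == p)%N) f i j
    + \sum_(1 <= j < p | (p < i + j)%N) f i j.
  rewrite [X in _ = X + _ + _]big_mkcond [X in _ = _ + X + _]big_mkcond.
  rewrite [X in _ = _ + X]big_mkcond -!big_split; apply: eq_bigr => j _ /=.
  by case: ltngtP => _; rewrite ?addr0 ?add0r.
rewrite (eq_bigr _ (fun i _ => split3 i)) !big_split /=; congr (_ + _ + _).
  rewrite -mulNr horner_finlog1 // -sumrN mulr_suml.
  apply: eq_big_nat => i /andP[i_gt0 lt_ip].
  rewrite (eq_bigl (fun j => j == (p - i)%N)); last by move=> j; lia.
  rewrite big_nat1_eq ifT; last by lia.
  rewrite /f subnKC ?(ltnW lt_ip) // natr_p_sub ?(ltnW lt_ip) // expr1n mulrN invrN.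
  by rewrite mulrN mulNr mul1r mulrC expr2.
rewrite big_nat_rev /= mulr_sumr; apply: eq_big_nat => i /andP[i_gt0 lt_ip].
rewrite add1n subSS big_nat_rev /= mulr_sumr big_mkcond [RHS]big_mkcond /=.
apply: eq_big_nat => j /andP[j_gt0 lt_jp]; rewrite add1n subSS.
rewrite (_ : (p < _)%N = (i + j < p)%N); last by lia.
case: ifP => // lt_ijp; rewrite /f !natr_p_sub ?(ltnW lt_ip) ?(ltnW lt_jp) //.
rewrite mulrNN mulrA exprVn; congr (_ / _).
rewrite (_ : p - i + (p - j) = p + p - (i + j))%N; last by lia.
have le_ij : (i + j <= p + p)%N by lia.
by rewrite -[in RHS](subnK le_ij) exprD mulfK ?expf_neq0.
Qed.

(** The equation forces P' = 1 + X + ... + X^(p-2), and in degree below p the derivative determines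
    all but the constant coefficient. *)
Lemma finlog1_uniq (P : {poly K}) :
  (size P <= p)%N -> P`_0 = 0 -> (1 - 'X) * P^`() = 1 - 'X^(p.-1) -> P = finlog 1.
Proof.
move=> sP P0 eqP'; apply/polyP => i; rewrite coef_finlog.
case: ltnP => [lt_ip|le_pi]; last by rewrite nth_default // (leq_trans sP).
case: i lt_ip => [|i] lt_ip; first by rewrite P0 expr1 invr0.
have : (i.+1%:R : K) * P`_i.+1 = 1.
  elim: i lt_ip => [|i IHi] lt_ip.
    have := congr1 (fun Q : {poly K} => Q`_0) eqP'.
    rewrite /= mulrBl mul1r mulrC coefB coefMX subr0 coef_deriv coefB coef1 coefXn.
    have p1_neq0 : (0%N == p.-1) = false by have := prime_gt1 p_prime; lia.
    by rewrite p1_neq0 subr0 mulr1n mul1r.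
  have := congr1 (fun Q : {poly K} => Q`_i.+1) eqP'.
  rewrite /= mulrBl mul1r mulrC coefB coefMX !coef_deriv coefB coef1 coefXn /=.
  have p1_neqi : (i.+1 == p.-1) = false by lia.
  rewrite -(mulr_natl P`_i.+2) -(mulr_natl P`_i.+1) IHi ?p1_neqi ?subr0; last by lia.
  by move=> /eqP; rewrite subr_eq0 => /eqP.
have nz : (i.+1%:R : K) != 0 by rewrite -(dvdn_pcharf pcharK) gtnNdvd.
by move=> eq1; apply: (mulfI nz); rewrite eq1 mulfV.
Qed.

Lemma deriv_finlog1 : (1 - 'X) * (finlog 1)^`() = 1 - 'X^(p.-1).
Proof.
have coef_d i : (finlog 1)^`()`_i = (i < p.-1)%:R.
  rewrite coef_deriv coef_finlog (_ : (i.+1 < p)%N = (i < p.-1)%N); last by lia.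
  case: ltnP => lt_ip; last by rewrite mul0rn.
  rewrite expr1 -(mulr_natl i.+1%:R^-1) mulfV // -(dvdn_pcharf pcharK) gtnNdvd //; lia.
apply/polyP => i; rewrite mulrBl mul1r mulrC coefB coefMX !coef_d coefB coef1 coefXn.
have [-> | i_gt0] := posnP i.
  by have := prime_gt1 p_prime; case: (p) => [|[|m]]; rewrite ?subr0.
have -> : (i.-1 < p.-1)%N = (i <= p.-1)%N by lia.
by case: ltngtP => _; rewrite ?subrr ?subr0 ?sub0r ?oppr0.
Qed.

Lemma deriv_finlog2 : 'X * (finlog 2)^`() = finlog 1.
Proof.
apply/polyP => -[|i]; rewrite mulrC coefMX coef_finlog ?invr0 ?if_same //=.
rewrite coef_deriv coef_finlog; case: ltnP => lt_ip; last by rewrite mul0rn.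
rewrite -(mulr_natl (i.+1%:R ^- 2)) expr2 invfM mulVKf //.
rewrite -(dvdn_pcharf pcharK) gtnNdvd //; lia.
Qed.

(** Inversion at 1 says that this value is its own opposite. *)
Lemma finlog1_at1 : (finlog 1).[1] = 0.
Proof.
have := @horner_finlogV 1 1 isT (oner_neq0 _).
rewrite invr1 expr1n mul1r expr1 mulN1r => /eqP; rewrite -subr_eq0 opprK.
by rewrite -mulr2n -mulr_natl mulf_eq0 (negPf natr2_neq0) /= => /eqP.
Qed.

Lemma comp_one_subX_deriv (P : {poly K}) :
  (P \Po (1 - 'X))^`() = - (P^`() \Po (1 - 'X)).
Proof. by rewrite deriv_comp derivB derivC derivX sub0r mulrN1. Qed.

Lemma size_one_subX : size (1 - 'X : {poly K}) = 2.
Proof. by rewrite -opprB size_polyN size_XsubC. Qed.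

Lemma pchar_polyK : p \in [pchar {poly K}].
Proof. by rewrite pchar_poly. Qed.

Lemma one_subX_exp : (1 - 'X : {poly K}) ^+ p = 1 - 'X^p.
Proof.
rewrite exprDn_pchar ?pnatE ?pchar_polyK // expr1n exprNn -signr_odd p_odd.
by rewrite mulN1r.
Qed.

(** The left-hand side satisfies the criterion [finlog1_uniq]: its value at 0 is [finlog1_at1], and
    the differential equation is transported using (1 - X)^p = 1 - X^p. *)
Lemma finlog1_reflect : finlog 1 \Po (1 - 'X) = finlog 1.
Proof.
apply: finlog1_uniq; first by rewrite size_comp_poly2 ?size_one_subX ?size_finlog.
  by rewrite -horner_coef0 horner_comp !hornerE subr0 finlog1_at1.
have X_neq0 : ('X : {poly K}) != 0 by rewrite -size_poly_gt0 size_polyX.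
rewrite comp_one_subX_deriv; apply: (mulfI X_neq0).
have := congr1 (fun Q : {poly K} => (Q \Po (1 - 'X))) deriv_finlog1.
rewrite /= comp_polyM !comp_polyB !comp_polyX !comp_polyC rmorphXn /= comp_polyX.
rewrite polyC1 subKr => eqd; rewrite mulrN mulrN mulrCA eqd mulrBr mulr1 opprB.
by rewrite -exprS prednK // one_subX_exp mulrBr mulr1 -exprS prednK //; ring.
Qed.

(** With L_n for [finlog n] and D = L_1^2 + 2 L_2(1 - X), the derivatives give (1 - X) D' = - 2 L_1
    X^(p-1). Hence D' vanishes below degree p - 1, and D is constant up to terms of degree at least
    p. *)
Lemma take_finlog1_sqr :
  take_poly p (finlog 1 ^+ 2) =
  (2 * (finlog 2).[1])%:P - 2%:P * (finlog 2 \Po (1 - 'X)).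
Proof.
set P := finlog 2 \Po (1 - 'X); pose D := finlog 1 ^+ 2 + 2%:P * P.
have eqD : (1 - 'X) * D^`() = - (2%:P * finlog 1) * 'X^(p.-1).
  have eqP : (1 - 'X) * P^`() = - finlog 1.
    rewrite /P comp_one_subX_deriv mulrN -finlog1_reflect -deriv_finlog2.
    by rewrite comp_polyM comp_polyX.
  have derivD2 : D^`() = 2 * (finlog 1 * (finlog 1)^`()) + 2%:P * P^`().
    by rewrite /D expr2 derivD !derivM derivC; ring.
  rewrite derivD2 mulrDr (mulrCA _ 2) (mulrCA _ (finlog 1)) deriv_finlog1.
  rewrite (mulrCA _ 2%:P) eqP.
  by rewrite (_ : 2%:P = 2 :> {poly K}) ?polyCMn //; ring.
have coefD0 i : (i < p)%N -> (i%:R : K) * D`_i = 0.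
  elim: i => [|i IHi] lt_ip; first by rewrite mul0r.
  have := congr1 (fun Q : {poly K} => Q`_i) eqD.
  rewrite /= mulrBl mul1r mulrC coefB coefMX coefMXn coefN coefCM coef_finlog.
  rewrite (_ : (if (i < p.-1)%N then _ else _) = 0); last first.
    case: ltnP => // le_pi.
    by rewrite (_ : i - p.-1 = 0)%N ?invr0 ?p_gt0 ?mulr0 ?oppr0 //; lia.
  case: i IHi lt_ip => [|i] IHi lt_ip; first by rewrite subr0 coef_deriv mulr_natl.
  rewrite !coef_deriv -(mulr_natl D`_i.+2) -(mulr_natl D`_i.+1) IHi ?subr0 //; lia.
have -> : finlog 1 ^+ 2 = D - 2%:P * P by rewrite addrK.
apply/polyP => i; rewrite coef_take_poly !coefB coefC.
case: ltnP => [lt_ip|le_pi]; last first.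
  rewrite coefCM [P`_i]nth_default ?mulr0 ?subr0; last first.
    by rewrite size_comp_poly2 ?size_one_subX ?(leq_trans (size_finlog 2)).
  by rewrite gtn_eqF ?(leq_trans p_gt0).
congr (_ - _); case: eqP => [-> | /eqP i_neq0].
  rewrite -horner_coef0 /D /P !hornerE horner_comp !hornerE subr0.
  by rewrite horner_coef0 coef_finlog p_gt0 expr1 invr0 ?expr0n ?mul0r add0r.
have := coefD0 i lt_ip => /eqP; rewrite mulf_eq0 -(dvdn_pcharf pcharK).
by rewrite gtnNdvd ?lt0n // => /eqP.
Qed.


(** Duplication at 1 reads 2 s = s / 2. The factor 3 stays because s is nonzero when p = 3. *)
Lemma three_finlog2_at1 : 3 * (finlog 2).[1] = 0.
Proof.
have := horner_finlog2_sqr 1; rewrite !expr1n subrr mul0r addr0.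
have := natr2_neq0; move: ((finlog 2).[1]) => s two_neq0 eq_s.
by rewrite (_ : 3 * s = 2 * ((1 + 1) * s) - s); [rewrite eq_s; field | ring].
Qed.

(* The reflection, inversion and duplication formulas at the golden ratio [y]
   form a linear system that determines both dilogarithm values. *)
Lemma take_finlog1_sqr_golden (y z : K) : y + z = 1 -> y * z = -1 ->
  5 * ((y ^+ p) ^+ 2 * (take_poly p (finlog 1 ^+ 2)).[z ^+ 2]
       - (z ^+ p) ^+ 2 * (take_poly p (finlog 1 ^+ 2)).[y ^+ 2]) =
  (finlog 1).[- y] ^+ 2 * (z ^+ p) ^+ 2 * (2 * y ^+ p - 1).
Proof.
move=> yDz yMz.
have y_neq0 : y != 0.
  by apply: contra_eq_neq yMz => ->; rewrite mul0r eq_sym oppr_eq0 oner_neq0.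
have zV : - z = y^-1 by apply: (mulfI y_neq0); rewrite mulrN yMz opprK mulfV.
have zE : z = 1 - y by rewrite -yDz addrC addKr.
have y2 : y ^+ 2 = y + 1.
  by rewrite -[1]opprK -yMz zE; ring.
have y2V : z ^+ 2 = (y ^+ 2)^-1 by rewrite -sqrrN zV exprVn.
have tDu : y ^+ p + z ^+ p = 1.
  by rewrite -exprDn_pchar ?pnatE // yDz expr1n.
have tMu : y ^+ p * z ^+ p = -1 by rewrite -exprMn yMz -signr_odd p_odd.
have Vx x : (take_poly p (finlog 1 ^+ 2)).[x] =
    2 * (finlog 2).[1] - 2 * (finlog 2).[1 - x].
  by rewrite take_finlog1_sqr !hornerE horner_comp !hornerE.
(* Thus the square relations at y^2 and at - y, used below, share their left-hand side. *)
have sym : (finlog 1).[y ^+ 2] = (finlog 1).[- y].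
  have <- : 1 - (- y) = y ^+ 2 by rewrite y2 opprK addrC.
  by rewrite -[in RHS]finlog1_reflect horner_comp !hornerE.
have s3 := three_finlog2_at1.
have eA : y ^+ p * (finlog 2).[- z] = (finlog 2).[y].
  by rewrite zV horner_finlogV // sqrrN expr1n mul1r.
have := horner_finlog1_sqr _ (expf_neq0 2 y_neq0).
have my_neq0 : - y != 0 by rewrite oppr_eq0.
have := horner_finlog1_sqr _ my_neq0.
have -> : (- y)^-1 = z by rewrite invrN -zV opprK.
have ypp : (y ^+ 2) ^+ (p + p) = (y ^+ p) ^+ 4.
  by rewrite -!exprM; congr (_ ^+ _); lia.
have mypp : (- y) ^+ (p + p) = (y ^+ p) ^+ 2.
  by rewrite exprD -expr2 exprNn -signr_odd p_odd mulN1r sqrrN.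
have -> : (- y) ^+ p = - y ^+ p by rewrite exprNn -signr_odd p_odd mulN1r.
rewrite ypp mypp (exprAC _ 2) -y2V sym !Vx.
have -> : 1 - y ^+ 2 = - y by rewrite y2; ring.
have -> : 1 - z ^+ 2 = - z by rewrite zE sqrrB y2; ring.
have -> : 1 - - y = y ^+ 2 by rewrite y2; ring.
have -> : 1 - z = y by rewrite -yDz addrK.
have := horner_finlog2_sqr y; rewrite -eA.
have := natr2_neq0.
(* By Frobenius t = y^p and u = z^p satisfy the same relations as y and z, which is all that is
   needed of them from here on. *)
move: (y ^+ p) (z ^+ p) tDu tMu => t u tDu tMu two_neq0.
have uE : u = 1 - t by rewrite -tDu addrC addKr.
have t2 : t ^+ 2 = t + 1.
  by rewrite -[1]opprK -tMu uE; ring.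
have t3 : t ^+ 3 = 2 * t + 1 by rewrite exprS t2 mulrDr -expr2 t2; ring.
have t4 : t ^+ 4 = 3 * t + 2 by rewrite exprS t3 mulrDr mulrCA -expr2 t2; ring.
have u2 : u ^+ 2 = 2 - t by rewrite uE sqrrB t2; ring.
move: ((finlog 2).[1]) s3 ((finlog 2).[- z]) ((finlog 2).[- y])
  ((finlog 2).[y ^+ 2]) ((finlog 1).[- y]) => s s3 A B C X e3 e2 e1.
have {}e3 : 2 * (1 + t) * (t * A) + 2 * (1 - t) * B - C = 0.
  by rewrite -!mulrA -mulrDr e3; field.
have {}e1 : (2 * s - 2 * B) - s * (t + 1) + 2 * s * (3 * t + 2)
            - 2 * (2 * t + 1) * (t * A) - X ^+ 2 = 0.
  by rewrite e1 -t3 -t4 -t2; ring.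
have {}e2 : (2 * s - 2 * C) + s * t + (t + 1) * (2 * s - 2 * (t * A)) - X ^+ 2 = 0.
  by rewrite e2 -t2; ring.
rewrite u2.
have -> : t ^+ 2 * (2 * s - 2 * A) = 2 * s * (t + 1) - 2 * t * (t * A).
  by rewrite -t2; ring.
have -> : X ^+ 2 * (2 - t) * (2 * t - 1) = X ^+ 2 * (3 * t - 4).
  transitivity (X ^+ 2 * (5 * t - 2 - 2 * t ^+ 2)); first by ring.
  by rewrite t2; ring.
move: (t * A) e1 e2 e3 => {}A e1 e2 e3.
have {}t2 : t ^+ 2 - t - 1 = 0 by rewrite t2; ring.
pose E1 := (2 * s - 2 * B) - s * (t + 1) + 2 * s * (3 * t + 2)
           - 2 * (2 * t + 1) * A - X ^+ 2.
pose E2 := (2 * s - 2 * C) + s * t + (t + 1) * (2 * s - 2 * A) - X ^+ 2.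
pose E3 := 2 * (1 + t) * A + 2 * (1 - t) * B - C.
(* Multipliers found by solving for the coefficients of A, B, C and X. *)
apply/eqP; rewrite -subr_eq0; apply/eqP.
transitivity ((t - 2) * E1 + (2 * t - 2) * E2 + (4 - 4 * t) * E3
  + (4 * t - 1) * (3 * s) - (11 * s - 16 * A + 8 * B) * (t ^+ 2 - t - 1)).
  by rewrite /E1 /E2 /E3; ring.
by rewrite /E1 /E2 /E3 e1 e2 e3 s3 t2 !mulr0 !addr0 subrr.
Qed.

End FinitePolylog.

(** * Expansion of (1 - X)^(p^a) modulo p^2 *)

Lemma exprDM_mod_sqr (R : comNzRingType) (x y c : R) n :
  exists z, (x + c * y) ^+ n = x ^+ n + n%:R * c * y * x ^+ n.-1 + c ^+ 2 * z.
Proof.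
elim: n => [|n [z IHn]]; first by exists 0; rewrite !expr0; ring.
exists (x * z + c * y * z + n%:R * y ^+ 2 * x ^+ n.-1); rewrite exprS IHn.
case: n {IHn} => [|n] /=; first by rewrite !expr0 expr1; ring.
by rewrite !exprS -[n.+2]addn1 natrD; ring.
Qed.

Lemma coef_one_subX_exp n i :
  ((1 - 'X) ^+ n : {poly int})`_i = (-1) ^+ i * 'C(n, i)%:Z.
Proof.
rewrite exprBn (eq_bigr (fun k : 'I_n.+1 => ((-1) ^+ k * 'C(n, k)%:Z) *: 'X^k)).
  rewrite -(poly_def n.+1 (fun k => (-1) ^+ k * 'C(n, k)%:Z)) coef_poly.
  by case: ltnP => // lt_ni; rewrite bin_small ?mulr0.
move=> k _; rewrite expr1n mulr1 -mul_polyC rmorphM /= rmorphXn rmorphN1 /=.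
by rewrite -natz polyC_natr -mulr_natr mulrAC.
Qed.

Section OddPrime.

Variable p : nat.
Hypotheses (p_prime : prime p) (p_odd : odd p).

Lemma one_subX_expp : exists2 g : {poly int}, (size g <= p)%N &
  (1 - 'X) ^+ p = 1 - 'X^p + p%:R * g :> {poly int}.
Proof.
(* At k = 0 the quotient ['C(p, 0) %/ p] is 0, so the constant term needs no separate formula. *)
exists (\poly_(k < p) ((-1) ^+ k * ('C(p, k) %/ p)%N%:Z)); first exact: size_poly.
have p_gt1 := prime_gt1 p_prime.
apply/polyP => i; rewrite coef_one_subX_exp -polyC_natr.
rewrite coefD coefB coef1 coefXn coefCM coef_poly (natz p).
have [-> | i_gt0] := posnP i.
  by rewrite bin0 ltnW // (ltn_eqF (ltnW p_gt1)) divn_small ?mulr0 // subr0 addr0 mulr1.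
case: ltngtP => [lt_ip|lt_pi|->].
- rewrite subr0 add0r [RHS]mulrCA -PoszM mulnC divnK //.
  by apply: prime_dvd_bin; rewrite ?i_gt0.
- by rewrite bin_small // !mulr0 subr0 addr0.
- by rewrite binn -signr_odd p_odd mulr0 sub0r addr0 mulr1.
Qed.

Variable g : {poly int}.
Hypotheses (size_g : (size g <= p)%N)
  (def_g : (1 - 'X) ^+ p = 1 - 'X^p + p%:R * g :> {poly int}).

Let p_neq0 : (p%:R : {poly int}) != 0.
Proof. by rewrite -polyC_natr polyC_eq0 natz; have := prime_gt0 p_prime; lia. Qed.

(** Differentiating [def_g] and cancelling p over the integers gives g' = X^(p-1) - (1 - X)^(p-1);
    modulo p, - g then meets the criterion [finlog1_uniq]. *)
Lemma map_fermat_quotient (K : fieldType) : p \in [pchar K] ->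
  map_poly intr g = - finlog K p 1.
Proof.
move=> pcharK; rewrite -[LHS]opprK; congr (- _); apply: finlog1_uniq => //.
- rewrite size_polyN; apply/leq_sizeP => i le_pi.
  by rewrite coef_map nth_default ?(leq_trans size_g).
- rewrite coefN coef_map /= (_ : g`_0 = 0) ?oppr0 //.
  have p_gt0 := prime_gt0 p_prime.
  have := congr1 (fun Q : {poly int} => Q`_0) def_g.
  rewrite /= coef_one_subX_exp bin0 -polyC_natr coefD coefB coef1 coefXn coefCM.
  rewrite (natz p) expr0.
  rewrite (ltn_eqF p_gt0) subr0 mulr1 => eq1.
  have /eqP : p%:Z * g`_0 = 0 by apply: (addrI 1); rewrite addr0 -eq1.
  by rewrite mulf_eq0 => /orP[/eqP p0|/eqP //]; lia.
have eq_g : g^`() = 'X^(p.-1) - (1 - 'X) ^+ p.-1.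
  apply: (mulfI p_neq0); have := congr1 (@deriv _) def_g.
  have d1 : (1 : {poly int})^`() = 0 by rewrite -polyC1 derivC.
  rewrite deriv_exp !derivD !derivN derivXn derivX d1 !sub0r.
  rewrite -polyC_natr derivM derivC mul0r add0r polyC_natr mulN1r mulNrn => eqd.
  rewrite -[LHS](addKr (- ('X^(p.-1) *+ p))) -eqd.
  by rewrite -(mulr_natl 'X^(p.-1)) -(mulr_natl ((1 - 'X) ^+ p.-1)); ring.
rewrite derivN deriv_map eq_g mulrN rmorphB /= map_polyXn rmorphXn /=.
rewrite rmorphB /= rmorph1 map_polyX.
have := prime_gt0 p_prime => p_gt0.
by rewrite mulrBr -exprS prednK // one_subX_exp // mulrBl mul1r -exprS prednK //; ring.
Qed.

(** In a p-th power, an error divisible by p only contributes multiples of p^2. The new term of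
    order p comes from (1 - X^r)^p alone, that is from [def_g] evaluated at X^r. *)
Lemma one_subX_exp_pow a : exists Q : {poly int},
  (1 - 'X) ^+ (p ^ a.+1)
  = 1 - 'X^(p ^ a.+1) + p%:R * (g \Po 'X^(p ^ a)) + p%:R ^+ 2 * Q.
Proof.
elim: a => [|a [Q IHa]].
  by exists 0; rewrite expn1 expn0 comp_polyXr mulr0 addr0.
have -> : (p ^ a.+2 = p ^ a.+1 * p)%N by rewrite -expnSr.
rewrite exprM IHa.
set B := g \Po _; rewrite -addrA expr2 -(mulrA p%:R) -mulrDr.
have [Q' ->] := exprDM_mod_sqr _ (1 - 'X^(p ^ a.+1)) (B + p%:R * Q) p%:R p.
set r := (p ^ a.+1)%N; set C := _ + p%:R * Q.
have -> : (1 - 'X^r) ^+ p = 1 - 'X^(r * p) + p%:R * (g \Po 'X^r) :> {poly int}.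
  have := congr1 (fun P : {poly int} => P \Po 'X^r) def_g.
  rewrite /= comp_polyD comp_polyB comp_polyM !rmorphXn /= comp_polyB !comp_polyX.
  by rewrite -polyC1 -polyC_natr !comp_polyC polyC1 polyC_natr exprM.
exists (C * (1 - 'X^r) ^+ p.-1 + Q'); ring.
Qed.
End OddPrime.

(** * The symbol modulo 5 and a fifth root of unity in characteristic p *)

Lemma legendre5E (n : nat) :
  legendre n 5 = if (5 %| n)%N then 0
                 else if (n %% 5 == 1)%N || (n %% 5 == 4)%N then 1 else -1.
Proof.
rewrite /legendre dvdzE /= /dvdn; case: eqP => // n_neq0.
have E : [exists x : 'I_5, ((x%:Z ^+ 2)%R == n %[mod 5%N%:Z])%Z] =
         [exists x : 'I_5, (x * x) %% 5 == n %% 5]%N.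
  by apply: eq_existsb => x; rewrite expr2 -PoszM !modz_nat eqz_nat.
have E2 m : [exists x : 'I_5, (x * x) %% 5 == m]%N =
            has (fun x => (x * x) %% 5 == m)%N (iota 0 5).
  apply/existsP/hasP => [[x sq_x]|[x]]; first by exists (val x); rewrite ?mem_iota /=.
  by rewrite mem_iota => lt_x5 sq_x; exists (Ordinal lt_x5).
rewrite E E2; move: n_neq0 (ltn_pmod n (isT : 0 < 5)%N).
by case: (n %% 5)%N => [|[|[|[|[|]]]]].
Qed.

(** A root of the fifth cyclotomic polynomial yields the golden ratio together with an explicit
    action of the Frobenius. *)
Lemma exists_fifth_root (p : nat) : prime p ->
  exists (K : fieldType) (zeta : K),
    p \in [pchar K] /\ 1 + zeta + zeta ^+ 2 + zeta ^+ 3 + zeta ^+ 4 = 0.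
Proof.
move=> p_prime; have [K [iota _]] := countable_algebraic_closure 'F_p.
pose P : {poly K} := \poly_(i < 5) 1.
have /closed_rootP[z rz] : size P != 1 by rewrite size_poly_eq ?oner_neq0.
exists K, z; split; first by rewrite (fmorph_pchar iota) pchar_Fp.
move: rz; rewrite /root /P horner_poly !big_ord_recr big_ord0 /= => /eqP <-.
by rewrite !mul1r add0r expr0 expr1.
Qed.

(** * Fibonacci sums weighted by the coefficients of h, where (1 - X)^q = 1 - X^q + p h *)

Section BinomialQuotient.

Variables (p q : nat) (h : {poly int}).
Hypotheses (p_gt0 : (0 < p)%N) (q_odd : odd q)
  (def_h : (1 - 'X) ^+ q = 1 - 'X^q + p%:R * h :> {poly int}).

Let q_gt0 : (0 < q)%N := odd_gt0 q_odd.

Lemma coef_binomial_quotient k : (k < q)%N ->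
  p%:Z * h`_k = (-1) ^+ k * 'C(q, k)%:Z - (k == 0%N)%:Z.
Proof.
move=> lt_kq; have := congr1 (fun Q : {poly int} => Q`_k) def_h.
rewrite /= coef_one_subX_exp -polyC_natr coefD coefB coef1 coefXn coefCM (natz p).
by rewrite (ltn_eqF lt_kq) subr0 (natz (k == 0%N)) => ->; rewrite addrC addKr.
Qed.

Lemma size_binomial_quotient : (size h <= q)%N.
Proof.
apply/leq_sizeP => k le_qk; have := congr1 (fun Q : {poly int} => Q`_k) def_h.
rewrite /= coef_one_subX_exp -polyC_natr coefD coefB coef1 coefXn coefCM (natz p).
rewrite (gtn_eqF (leq_trans q_gt0 le_qk)) sub0r => eqk.
have /eqP : p%:Z * h`_k = 0.
  apply: (addrI (- (k == q)%:R)); rewrite -eqk addr0.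
  move: le_qk; rewrite leq_eqVlt => /orP[/eqP <-|lt_qk].
    by rewrite binn eqxx -signr_odd q_odd mulr1.
  by rewrite bin_small // mulr0 gtn_eqF // oppr0.
by rewrite mulf_eq0 => /orP[/eqP p0|/eqP //]; lia.
Qed.

(** Below X^q, (1 - X)^(2q) agrees with (1 + p h)^2 = 2 (1 + p h) - 1 + p^2 h^2. The first part sums
    to 2 F_q by [sum_signed_bin_fib], the constant - 1 gives - F_(2q). *)
Lemma central_bin_sum_fib :
  \sum_(k < q) (-1) ^+ k * 'C(2 * k, k)%:Z =
  2 * F q - F (q + q) + p%:Z ^+ 2 * \sum_(k < q) (h ^+ 2)`_k * F (2 * (q - k)).
Proof.
rewrite sum_signed_central_bin.
have coef2 k : (k < q)%N -> (-1) ^+ k * 'C(2 * q, k)%:Z =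
    2 * ((-1) ^+ k * 'C(q, k)%:Z) - (k == 0%N)%:Z + p%:Z ^+ 2 * (h ^+ 2)`_k.
  move=> lt_kq; rewrite -coef_one_subX_exp mulnC exprM def_h.
  have -> : (1 - 'X^q + p%:R * h) ^+ 2 =
      1 + (2 * p%:Z)%:P * h + (p%:Z ^+ 2)%:P * h ^+ 2
      + ('X^q - 2 - (2 * p%:Z)%:P * h) * 'X^q.
    by rewrite polyC_exp polyCM -natz !polyC_natr; ring.
  rewrite coefD coefMXn lt_kq addr0 !coefD coef1 !coefCM -mulrA.
  rewrite coef_binomial_quotient // (natz (k == 0%N)); ring.
rewrite (eq_bigr (fun k : 'I_q => 2 * ('C(q, k)%:Z * ((-1) ^+ k * F (2 * (q - k) + 0)))
   - (k == 0%N :> nat)%:Z * F (2 * (q - k))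
   + p%:Z ^+ 2 * ((h ^+ 2)`_k * F (2 * (q - k))))); last first.
  by move=> k _; rewrite [LHS]mulrCA [LHS]mulrA coef2 // addn0; ring.
rewrite !big_split /= -!mulr_sumr sumrN; congr (_ - _ + _).
  congr (_ * _); have := sum_signed_bin_fib q 0; rewrite addn0 => <-.
  by rewrite [RHS]big_ord_recr /= subnn !mulr0 addr0.
case: q q_gt0 => // q' _; rewrite big_ord_recl big1 ?addr0 ?mul1r ?subn0.
  by congr (F _); lia.
by move=> i _; rewrite mul0r.
Qed.

(** This is [sum_bin_fib] without its term k = q and with the coefficient 1 at k = 0 removed. *)
Lemma binomial_quotient_fib m :
  p%:Z * \sum_(k < q) h`_k * (-1) ^+ k * F (k + m) = F (q + q + m) - F (q + m) - F m.
Proof.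
rewrite -sum_bin_fib big_ord_recr /= binn mul1r addrK mulr_sumr.
rewrite (eq_bigr (fun k : 'I_q => 'C(q, k)%:Z * F (k + m)
   - (k == 0%N :> nat)%:Z * F (k + m))); last first.
  move=> k _; rewrite !mulrA coef_binomial_quotient //.
  case: (nat_of_ord k) => [|k'] /=; first by rewrite bin0; ring.
  transitivity (((-1) ^+ k'.+1) ^+ 2 * 'C(q, k'.+1)%:Z * F (k'.+1 + m)).
    by ring.
  by rewrite sqrr_sign; ring.
rewrite big_split /= sumrN; congr (_ - _).
case: q q_gt0 => // q' _; rewrite big_ord_recl big1 ?addr0 ?mul1r //.
Qed.

Variables (l : int).
Hypothesis (def_l : 2 * F q.+1 - F q = 1 + p%:Z * l).

Let cassini_q : F q.+1 ^+ 2 - F q.+1 * F q - F q ^+ 2 = -1.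
Proof. by rewrite cassini -signr_odd q_odd. Qed.

(** The right-hand sides of [binomial_quotient_fib] at m = 0 and m = 1 are F_q (L_q - 1) and F_(q+1)
    (L_q - 1); the second uses Cassini's identity to rewrite F_1. *)
Lemma binomial_quotient_lucas :
  \sum_(k < q) h`_k * (-1) ^+ k * F (k + 0) = l * F q /\
  \sum_(k < q) h`_k * (-1) ^+ k * F (k + 1) = l * F q.+1.
Proof.
have p_neq0 : p%:Z != 0 by lia.
have [F2q F2q1] := fib_double q.
have pl : p%:Z * l = 2 * F q.+1 - F q - 1 by rewrite def_l addrC addKr.
split; apply: (mulfI p_neq0); rewrite binomial_quotient_fib mulrA pl.
  by rewrite !addn0 F2q (_ : F 0 = 0) //; ring.
have -> : F 1 = - (F q.+1 ^+ 2 - F q.+1 * F q - F q ^+ 2).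
  by rewrite cassini_q opprK.
by rewrite !addn1 F2q1; ring.
Qed.

Variables (K : fieldType) (x y : K).
Hypotheses (xDy : x + y = 1) (xMy : x * y = -1) (xBy_neq0 : x - y != 0).

(** Formally p h(- x) = (1 + x)^q - 1 - x^q = x^q (L_q - 1), as 1 + x = x^2. Since p may vanish in
    K, the division by p is carried out on the integer sums of [binomial_quotient_lucas]. *)
Lemma horner_binomial_quotient :
  (map_poly intr h).[- x] = l%:~R * x ^+ q.
Proof.
have sum_h m : (x - y) * (\sum_(k < q) h`_k * (-1) ^+ k * F (k + m))%:~R =
    x ^+ m * (map_poly intr h).[- x] - y ^+ m * (map_poly intr h).[- y].
  have hE (z : K) : (map_poly intr h).[- z] =
      \sum_(k < q) (h`_k)%:~R * ((-1) ^+ k * z ^+ k).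
    rewrite (@horner_coef_wide _ q).
      by apply: eq_bigr => k _; rewrite coef_map /= (exprNn z).
    apply/leq_sizeP => k le_qk.
    by rewrite coef_map nth_default // (leq_trans size_binomial_quotient).
  rewrite !hE !mulr_sumr -sumrB rmorph_sum mulr_sumr; apply: eq_bigr => k _.
  by rewrite !rmorphM rmorphXn rmorphN1 /= mulrCA binet // !exprD; ring.
have [l0 l1] := binomial_quotient_lucas.
have := sum_h 0; have := sum_h 1; rewrite l0 l1 !intrM !expr0 !expr1 !mul1r.
rewrite !(mulrCA (x - y)) !binet // !exprS => e1 e0.
apply: (mulfI xBy_neq0).
(* The sums for m = 0 and m = 1 form a linear system in h(- x) and h(- y); this combination
   eliminates h(- y). *)
transitivity (x * (map_poly intr h).[- x] - y * (map_poly intr h).[- y]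
  - y * ((map_poly intr h).[- x] - (map_poly intr h).[- y])); first by ring.
by rewrite -e1 -e0; ring.
Qed.

End BinomialQuotient.

(** * The golden ratio in characteristic p and its Frobenius conjugates *)

Section GoldenFrobenius.

Variables (K : fieldType) (p a : nat) (zeta : K).
Hypotheses (pcharK : p \in [pchar K]) (p_odd : odd p) (p_neq5 : p <> 5%N)
  (zeta_root : 1 + zeta + zeta ^+ 2 + zeta ^+ 3 + zeta ^+ 4 = 0).

Let p_prime : prime p := pcharf_prime pcharK.

(* The golden ratio and its conjugate as Gauss periods: the Frobenius fixes or
   swaps them according to the class of p modulo 5. *)
Let x := - (zeta ^+ 2 + zeta ^+ 3).
Let y := - (zeta + zeta ^+ 4).

Lemma golden_sum : x + y = 1.
Proof.
apply/eqP; rewrite -subr_eq0 -oppr_eq0 -[X in _ == X]zeta_root; apply/eqP.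
by rewrite /x /y; ring.
Qed.

Lemma zeta_exp5 : zeta ^+ 5 = 1.
Proof.
apply/eqP; rewrite -subr_eq0 -[X in _ == X](mulr0 (zeta - 1)).
rewrite -[in X in _ == X]zeta_root.
by apply/eqP; ring.
Qed.

Lemma golden_prod : x * y = -1.
Proof.
transitivity (zeta ^+ 3 + zeta ^+ 4 + zeta * zeta ^+ 5 + zeta ^+ 2 * zeta ^+ 5).
  by rewrite /x /y; ring.
rewrite zeta_exp5; apply/eqP; rewrite -subr_eq0 opprK -[X in _ == X]zeta_root.
by apply/eqP; ring.
Qed.

Lemma natr5_neq0 : (5 : K) != 0.
Proof.
by rewrite -[5]/(5%:R) -(dvdn_pcharf pcharK) dvdn_prime2 //; apply/eqP.
Qed.

Lemma golden_sub_sqr : (x - y) ^+ 2 = 5.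
Proof.
transitivity ((x + y) ^+ 2 - 4 * (x * y)); first by ring.
by rewrite golden_sum golden_prod; ring.
Qed.

Lemma golden_sub_neq0 : x - y != 0.
Proof. by have := natr5_neq0; rewrite -golden_sub_sqr expf_eq0. Qed.

(** With Binet's formula this yields F_q = (q/5) modulo p. *)
Lemma golden_frobenius :
  x ^+ (p ^ a) - y ^+ (p ^ a) = (legendre (p ^ a)%N 5)%:~R * (x - y).
Proof.
have pq : [pchar K].-nat (p ^ a)%N by rewrite pnatX pnatE // pcharK.
have q_odd : odd (p ^ a) by rewrite oddX p_odd orbT.
have expN (u : K) : (- u) ^+ (p ^ a) = - u ^+ (p ^ a).
  by rewrite exprNn -signr_odd q_odd mulN1r.
rewrite /x /y !expN !exprDn_pchar // legendre5E.
have q5 : (5 %| p ^ a)%N = false.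
  apply/negP; rewrite Euclid_dvdX // => /andP[].
  by rewrite dvdn_prime2 // => /eqP p5; case: p_neq5.
have expz n : zeta ^+ n = zeta ^+ (n %% 5) by rewrite -(expr_mod n zeta_exp5).
have expzq k : (zeta ^+ k) ^+ (p ^ a) = zeta ^+ (k * (p ^ a %% 5) %% 5).
  by rewrite -exprM expz modnMmr.
rewrite q5 !expzq (expz (p ^ a)%N).
move: q5; rewrite /dvdn; have := ltn_pmod (p ^ a) (isT : 0 < 5)%N.
(* Residues 1 and 4 preserve the exponent pairs {1, 4} and {2, 3}; residues 2 and 3 exchange
   them. *)
case: (p ^ a %% 5)%N => [|[|[|[|[|]]]]] // _ _ /=; rewrite ?expr1; ring.
Qed.

End GoldenFrobenius.

(** * The congruence modulo p^3 from identities in K *)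

Section Congruence.

Variables (K : fieldType) (p a : nat) (x y : K).
Hypotheses (pcharK : p \in [pchar K]) (p_odd : odd p)
  (xDy : x + y = 1) (xMy : x * y = -1) (xBy_sqr : (x - y) ^+ 2 = 5)
  (xBy_neq0 : x - y != 0).

Let p_prime : prime p := pcharf_prime pcharK.
Let q := (p ^ a.+1)%N.
Let r := (p ^ a)%N.

(** L_q = x^q + y^q = (x + y)^q by Frobenius. *)
Lemma lucas_mod_p : (2 * F q.+1 - F q)%:~R = 1 :> K.
Proof.
apply: (mulfI xBy_neq0); rewrite intrB intrM mulrBr mulrCA !binet //.
transitivity ((x ^+ q + y ^+ q) * (x - y)).
  rewrite !exprS.
  transitivity (x ^+ q * (2 * x - (x + y)) - y ^+ q * (2 * y - (x + y))).
    by rewrite xDy; ring.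
  by ring.
rewrite -exprDn_pchar ?xDy ?expr1n ?mul1r ?mulr1 //.
by rewrite pnatX pnatE // pcharK.
Qed.

(** By Binet and x y = -1, x - y times the sum is x^(2q) T(y^2) - y^(2q) T(x^2), with T the part of
    h^2 below X^q. As T is a polynomial in X^r, [take_finlog1_sqr_golden] applies at x^r and y^r,
    which again have sum 1 and product -1. *)
Lemma square_part_mod_p (h : {poly int}) (l : int) :
  map_poly intr h = - (finlog K p 1 \Po 'X^r) ->
  (map_poly intr h).[- x] = l%:~R * x ^+ q ->
  5 * (\sum_(k < q) (h ^+ 2)`_k * F (2 * (q - k)))%:~R = l%:~R ^+ 2 * (F q)%:~R :> K.
Proof.
move=> hE hx; apply: (mulfI xBy_neq0).
have p_gt0 := prime_gt0 p_prime.
have r_gt0 : (0 < r)%N by rewrite expn_gt0 p_gt0.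
have qE : q = (r * p)%N by rewrite /q expnSr.
have r_odd : odd r by rewrite oddX p_odd orbT.
have rK : [pchar K].-nat r by rewrite pnatX pnatE // pcharK.
(* Substituting X^r turns truncation at p into truncation at q = r p. *)
have takeE : take_poly q (map_poly intr (h ^+ 2)) =
    take_poly p (finlog K p 1 ^+ 2) \Po 'X^r.
  rewrite rmorphXn /= hE sqrrN -rmorphXn /=; apply/polyP => i.
  rewrite coef_take_poly !coef_comp_poly_Xn // coef_take_poly.
  rewrite ltn_divLR // (mulnC p) -qE.
  by case: ifP; rewrite ?if_same.
have xE : x ^+ q = (x ^+ r) ^+ p by rewrite qE exprM.
have yE : y ^+ q = (y ^+ r) ^+ p by rewrite qE exprM.
have q_odd : odd q by rewrite oddX p_odd orbT.
have xyq : x ^+ q * y ^+ q = -1 by rewrite -exprMn xMy -signr_odd q_odd.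
have xyr : x ^+ r * y ^+ r = -1 by rewrite -exprMn xMy -signr_odd r_odd.
have xDyr : x ^+ r + y ^+ r = 1 by rewrite -exprDn_pchar ?xDy ?expr1n.
have xDyq : x ^+ q + y ^+ q = 1.
  by rewrite -exprDn_pchar ?xDy ?expr1n // pnatX pnatE // pcharK.
have pow2 (u v : K) k n : u * v = -1 -> (k <= n)%N ->
    u ^+ (2 * (n - k)) = (u ^+ n) ^+ 2 * (v ^+ 2) ^+ k.
  move=> uv le_kn; rewrite -{2}(subnK le_kn) exprD exprMn -mulrA (exprAC u k 2).
  by rewrite -exprMn -[u ^+ 2 * _]exprMn uv sqrrN !expr1n mulr1 mulnC exprM.
have yMx : y * x = -1 by rewrite mulrC.
have takeh z : (take_poly q (map_poly intr (h ^+ 2))).[z] =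
    \sum_(k < q) ((h ^+ 2)`_k)%:~R * z ^+ k :> K.
  by rewrite horner_poly; apply: eq_bigr => k _; rewrite coef_map.
have -> : (x - y) * (5 * (\sum_(k < q) (h ^+ 2)`_k * F (2 * (q - k)))%:~R) =
    5 * ((x ^+ q) ^+ 2 * (take_poly q (map_poly intr (h ^+ 2))).[y ^+ 2]
       - (y ^+ q) ^+ 2 * (take_poly q (map_poly intr (h ^+ 2))).[x ^+ 2]).
  rewrite mulrCA; congr (_ * _); rewrite !takeh !mulr_sumr -sumrB rmorph_sum mulr_sumr.
  apply: eq_bigr => k _; rewrite rmorphM /= mulrCA binet //.
  have le_kq := ltnW (ltn_ord k).
  by rewrite (pow2 x y) // (pow2 y x) //; ring.
rewrite takeE !horner_comp !hornerXn (exprAC _ 2 r) (exprAC _ 2 r) xE yE.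
rewrite (take_finlog1_sqr_golden _ _ pcharK p_odd _ _ xDyr xyr) -xE -yE.
have -> : (finlog K p 1).[- x ^+ r] = - (l%:~R * x ^+ q).
  by rewrite -hx hE hornerN horner_comp hornerXn opprK exprNn -signr_odd r_odd mulN1r.
rewrite [RHS]mulrCA binet // sqrrN exprMn.
(* Here 2 x^q - 1 = x^q - y^q, which Binet identifies with (x - y) F_q. *)
transitivity (l%:~R ^+ 2 * ((x ^+ q * y ^+ q) ^+ 2 * (2 * x ^+ q - 1))); first by ring.
by rewrite xyq -[X in _ - X]xDyq; ring.
Qed.

(** The difference is p^2 W + (F_q - e) (1 - L_q) = p^2 (W - f l). Modulo p, 5 W = l^2 F_q, F_q = e
    and l = 5 e f, so that W = f l. *)
Lemma congruence_mod_p3 (h : {poly int}) (e f l : int) :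
  (1 - 'X) ^+ q = 1 - 'X^q + p%:R * h ->
  map_poly intr h = - (finlog K p 1 \Po 'X^r) ->
  e ^+ 2 = 1 -> F q = e + p%:Z * f -> 2 * F q.+1 - F q = 1 + p%:Z * l ->
  (p%:Z ^+ 3 %| \sum_(k < q) (-1) ^+ k * 'C(2 * k, k)%:Z
    - (e + F q - e * (2 * F q.+1 - F q)))%Z.
Proof.
move=> def_h hE e2 Fq Lq.
have p_gt0 := prime_gt0 p_prime.
have q_odd : odd q by rewrite oddX p_odd orbT.
rewrite (central_bin_sum_fib p q h p_gt0 q_odd def_h).
set W := \sum_(k < q) _; have [F2q _] := fib_double q.
have -> : 2 * F q - F (q + q) + p%:Z ^+ 2 * W - (e + F q - e * (2 * F q.+1 - F q))
          = p%:Z ^+ 2 * (W - f * l).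
  by rewrite F2q Lq Fq; ring.
have -> : p%:Z ^+ 3 = p%:Z ^+ 2 * p%:Z by ring.
apply: dvdz_mul; first exact: dvdzz.
rewrite (dvdz_pcharf pcharK) intrB intrM subr_eq0.
have hx := horner_binomial_quotient _ _ _ p_gt0 q_odd def_h _ Lq _ _ _ xDy xMy xBy_neq0.
have W5 := square_part_mod_p _ _ hE hx.
have five_neq0 : (5 : K) != 0 by rewrite -xBy_sqr expf_neq0.
have two_neq0 := natr2_neq0 _ _ pcharK p_odd.
have pK : (p%:Z)%:~R = 0 :> K by rewrite -pmulrn pcharf0.
have lE : l%:~R = 5 * e%:~R * f%:~R :> K.
  (* Substitute into L_q^2 + 4 = 5 F_q^2, use e^2 = 1 and divide by p. *)
  have eq_l : 2 * l + p%:Z * l ^+ 2 = 10 * e * f + 5 * p%:Z * f ^+ 2.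
    have p_neq0 : p%:Z != 0 by lia.
    have cas : F q.+1 ^+ 2 - F q.+1 * F q - F q ^+ 2 = -1.
      by rewrite cassini -signr_odd q_odd.
    have lucas_sqr : (2 * F q.+1 - F q) ^+ 2 + 4 = 5 * F q ^+ 2.
      rewrite (_ : 4 = - (4 * (-1))) // -cas; ring.
    apply: (mulfI p_neq0).
    transitivity ((1 + p%:Z * l) ^+ 2 + 4 - 5); first by ring.
    rewrite -Lq lucas_sqr Fq -[X in _ - X](mulr1 5) -e2; ring.
  have := congr1 (fun z : int => z%:~R : K) eq_l.
  rewrite /= !intrD !intrM pK !(mul0r, mulr0) !addr0 => eqK.
  by apply: (mulfI two_neq0); rewrite eqK; ring.
apply/eqP; apply: (mulfI five_neq0); rewrite W5 Fq intrD intrM pK mul0r addr0.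
have e2K : e%:~R ^+ 2 = 1 :> K by rewrite -rmorphXn /= e2.
transitivity (5 * f%:~R * l%:~R * e%:~R ^+ 2 : K); last by rewrite e2K; ring.
by rewrite {1}expr2 {1}lE; ring.
Qed.

End Congruence.
(* The index p ^ a - (p ^ a / 5) is at least 2, so the absolute value only
   converts it from int to nat. *)
Theorem theorem1p3 (p a : nat) (p_prime : prime p) (p_neq2 : p <> 2%N)
    (p_neq5 : p <> 5%N) (a_gt0 : (0 < a)%N) :
  (\sum_(k < p ^ a) (-1) ^+ k * 'C(2 * k, k)%:Z
   = legendre (p ^ a)%N%:Z 5
     * (1 - 2 * (fib (absz ((p ^ a)%N%:Z - legendre (p ^ a)%N%:Z 5)%R))%:Z)
   %[mod p%:Z ^+ 3])%Z.
Proof.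
have p_odd : odd p by case: (even_prime p_prime) => // p2; case: p_neq2.
case: a a_gt0 => // a _.
have [K [zeta [pcharK zeta_root]]] := exists_fifth_root p p_prime.
have xDy := golden_sum _ _ zeta_root.
have xMy := golden_prod _ _ zeta_root.
have xBy_sqr := golden_sub_sqr _ _ zeta_root.
have xBy_neq0 := golden_sub_neq0 _ _ _ pcharK p_neq5 zeta_root.
have := golden_frobenius _ _ a.+1 _ pcharK p_odd p_neq5 zeta_root.
set x := - (zeta ^+ 2 + _) in xDy xMy xBy_sqr xBy_neq0 *.
set y := - (zeta + _) in xDy xMy xBy_sqr xBy_neq0 *.
have [g size_g def_g] := one_subX_expp p p_prime p_odd.
have [Q def_q] := one_subX_exp_pow p g def_g a.
have hE : map_poly intr (g \Po 'X^(p ^ a) + p%:R * Q) =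
    - (finlog K p 1 \Po 'X^(p ^ a)).
  rewrite rmorphD rmorphM rmorph_nat /= map_comp_poly /= map_polyXn.
  rewrite (map_fermat_quotient p p_prime p_odd g size_g def_g K pcharK).
  rewrite -polyC_natr (pcharf0 pcharK) mul0r addr0.
  by rewrite -[- finlog K p 1]sub0r comp_polyB comp_poly0 sub0r.
have {}def_q : (1 - 'X) ^+ (p ^ a.+1) = 1 - 'X^(p ^ a.+1)
    + p%:R * (g \Po 'X^(p ^ a) + p%:R * Q) :> {poly int}.
  by rewrite def_q mulrDr mulrA expr2 addrA.
have Lp := lucas_mod_p _ _ a _ _ pcharK xDy xMy xBy_neq0.
have eps2 : legendre (p ^ a.+1)%N 5 ^+ 2 = 1.
  rewrite legendre5E Euclid_dvdX // dvdn_prime2 //.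
  by rewrite (introF eqP (fun e => p_neq5 (esym e))) /=; case: ifP.
set e := legendre _ _ in eps2 *; rewrite -binet // mulrC => /(mulIf xBy_neq0) Fe.
have /dvdzP[f def_f] : (p %| F (p ^ a.+1) - e)%Z.
  by rewrite (dvdz_pcharf pcharK) intrB Fe subrr.
have /dvdzP[l def_l] : (p %| 2 * F (p ^ a.+1).+1 - F (p ^ a.+1) - 1)%Z.
  by rewrite (dvdz_pcharf pcharK) intrB Lp subrr.
have Ff : F (p ^ a.+1) = e + p%:Z * f by rewrite (mulrC p%:Z) -def_f addrC subrK.
have Ll : 2 * F (p ^ a.+1).+1 - F (p ^ a.+1) = 1 + p%:Z * l.
  by rewrite (mulrC p%:Z) -def_l [RHS]addrC subrK.
have := congruence_mod_p3 _ _ _ _ _ pcharK p_odd xDy xMy xBy_sqr xBy_neq0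
  _ _ _ _ def_q hE eps2 Ff Ll.
rewrite -eqz_mod_dvd => /eqP ->; congr (_ %% _)%Z.
have q_gt0 : (0 < p ^ a.+1)%N by rewrite expn_gt0 prime_gt0.
(* For e = 1 the expression e + F_q - e L_q is 1 - 2 F_(q-1); for e = -1 it is - (1 - 2 F_(q+1)). *)
have : e = 1 \/ e = -1.
  by move/eqP: eps2; rewrite sqrf_eq1 => /orP[] /eqP; [left | right].
clear -q_gt0; case: (p ^ a.+1)%N q_gt0 => // n _ [] -> {e}.
  have -> : absz (n.+1%:Z - 1)%R = n by lia.
  by rewrite fibSS; ring.
have -> : absz (n.+1%:Z - -1)%R = n.+2 by lia.
by ring.
Qed.
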